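(* Let $\mathcal{S}$ be a numerical semigroup minimally generated by $A=\{a_1,\ldots,a_n\}$, where $a_j=f_j\prod_{i\neq j}d_i$ for all $j\in\{1,\ldots,n\}$, with $d_1,\ldots,d_n\in\mathbb{Z}^+$ pairwise coprime and $f_1=1$, $f_2,\ldots,f_n\in\mathbb{Z}^+$ satisfying $\gcd(d_j,f_j)=1$ for all $j\in\{1,\ldots,n\}$. Then $\mathcal{S}$ is a circuit numerical semigroup and is free for the arrangement $(a_2,\ldots,a_n,a_1)$.
   Context: $\mathbb{K}$ is an arbitrary field and $\mathbb{N}$ contains $0$. For positive integers $a_1,\ldots,a_n$, $\langle a_1,\ldots,a_n\rangle=\{u_1a_1+\cdots+u_na_n\mid u_i\in\mathbb{N}\}$. A numerical semigroup is a submonoid of $\mathbb{N}$ generated by a finite set of positive integers with greatest common divisor $1$; its minimal generating set is its unique generating set no proper subset of which generates it. For $A=\{a_1,\ldots,a_n\}$, the $A$-degree of $\mathbf{x}^{\mathbf{u}}=x_1^{u_1}\cdots x_n^{u_n}$ is $u_1a_1+\cdots+u_na_n$, and the toric ideal of $A$ is $I_A=\langle \mathbf{x}^{\mathbf{u}}-\mathbf{x}^{\mathbf{v}}\mid \deg_A(\mathbf{x}^{\mathbf{u}})=\deg_A(\mathbf{x}^{\mathbf{v}})\rangle\subseteq\mathbb{K}[x_1,\ldots,x_n]$. A binomial $\mathbf{x}^{\mathbf{u}}-\mathbf{x}^{\mathbf{v}}\in I_A$ is irreducible if $\operatorname{supp}(\mathbf{u})\cap\operatorname{supp}(\mathbf{v})=\emptyset$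 (where $\operatorname{supp}(\mathbf{u})=\{i\mid u_i\ne0\}$) and the nonzero entries of $\mathbf{u}+\mathbf{v}$ are relatively prime; a circuit is an irreducible binomial of $I_A$ whose support $\operatorname{supp}(\mathbf{u})\cup\operatorname{supp}(\mathbf{v})$ is inclusion-minimal among nonzero binomials of $I_A$. Equivalently, the set of circuits is $\mathcal{C}_A=\{x_i^{a_j/\gcd(a_i,a_j)}-x_j^{a_i/\gcd(a_i,a_j)}\mid i\neq j\}$. A numerical semigroup with minimal generating set $A$ is a circuit numerical semigroup if $I_A=\langle\mathcal{C}_A\rangle$. A numerical semigroup whose minimal generating set, listed in some order, is $(b_1,\ldots,b_n)$ is free for the arrangement $(b_1,\ldots,b_n)$ if $\operatorname{lcm}\big(b_i,\gcd(b_{i+1},\ldots,b_n)\big)\in\langle b_{i+1},\ldots,b_n\rangle$ for all $i\in\{1,\ldots,n-1\}$. *)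

(* Defs.v *)
From HB Require Import structures.
From mathcomp Require Import all_boot all_order all_algebra.
From mathcomp Require Import mpoly.

Set Implicit Arguments.
Unset Strict Implicit.
Unset Printing Implicit Defensive.

Import GRing.Theory.

(* Finite sets of generators are given by duplicate-free lists, so that the    *)
(* i-th variable of the polynomial ring corresponds to the i-th generator.     *)

Definition nat_span (s : seq nat) (x : nat) : Prop :=
  exists u : nat -> nat, x = \sum_(i < size s) u i * nth 0 s i.

Definition generates (s : seq nat) (S : nat -> Prop) : Prop :=
  forall x, S x <-> nat_span s x.

Definition numerical_semigroup (S : nat -> Prop) : Prop :=
  exists G : seq nat,
    [/\ all (fun g => 0 < g) G, \big[gcdn/0]_(g <- G) g = 1 & generates G S].

Definition minimal_generating_set (S : nat -> Prop) (A : seq nat) : Prop :=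
  [/\ uniq A,
      all (fun a => 0 < a) A,
      generates A S
    & forall B : seq nat,
        {subset B <= A} -> ~ {subset A <= B} -> ~ generates B S].

Definition ideal_gen (R : comNzRingType) (G : R -> Prop) (p : R) : Prop :=
  exists s : seq (R * R),
    (forall cg, cg \in s -> G cg.2) /\ p = (\sum_(cg <- s) cg.1 * cg.2)%R.

Section ToricIdeal.
Variables (K : fieldType) (n : nat) (A : n.-tuple nat).

Definition Adeg (u : 'X_{1..n}) : nat := \sum_(i < n) u i * tnth A i.

Definition mbinomial (u v : 'X_{1..n}) : {mpoly K[n]} := ('X_[u] - 'X_[v])%R.

Definition toric_ideal : {mpoly K[n]} -> Prop :=
  ideal_gen (fun p => exists u v, Adeg u = Adeg v /\ p = mbinomial u v).

Definition supp (u : 'X_{1..n}) : {set 'I_n} := [set i | u i != 0].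

Definition irreducible_binomial (u v : 'X_{1..n}) : Prop :=
  [/\ toric_ideal (mbinomial u v),
      supp u :&: supp v = set0
    & \big[gcdn/0]_(i < n | u i + v i != 0) (u i + v i) = 1].

Definition circuit (p : {mpoly K[n]}) : Prop :=
  exists u v : 'X_{1..n},
    [/\ p = mbinomial u v,
        irreducible_binomial u v
      & forall u' v' : 'X_{1..n},
          mbinomial u' v' <> 0%R -> toric_ideal (mbinomial u' v') ->
          supp u' :|: supp v' \subset supp u :|: supp v ->
          supp u' :|: supp v' = supp u :|: supp v].

End ToricIdeal.

Definition circuit_numerical_semigroup
    (K : fieldType) (S : nat -> Prop) (n : nat) (A : n.-tuple nat) : Prop :=
  [/\ numerical_semigroup S,
      minimal_generating_set S A
    & forall p : {mpoly K[n]},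
        toric_ideal A p <-> ideal_gen (@circuit K n A) p].

(* [nth 0 b i] is the (i+1)-st generator of the arrangement [b], and           *)
(* [drop i.+1 b] lists the generators that come after it.                      *)
Definition free_for_arrangement (S : nat -> Prop) (b : seq nat) : Prop :=
  [/\ numerical_semigroup S,
      minimal_generating_set S b
    & forall i : nat, i < (size b).-1 ->
        nat_span (drop i.+1 b)
             (lcmn (nth 0 b i) (\big[gcdn/0]_(c <- drop i.+1 b) c))].

(* Main.v *)
Require Import Defs.
From HB Require Import structures.
From mathcomp Require Import all_boot all_order all_algebra.
From mathcomp Require Import mpoly.

(** Write [a_i] for the generators, numbered from 0, so that [f_0 = 1], and let
    [D] be the product of all the [d_i], so that [d_i * a_i = f_i * D].  Since
    [f_0 = 1], this number is [f_i * d_0 * a_0]: a multiple of [a_0].  Moreover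
    [d_i] is coprime to [a_i] and divides every other generator.  Both claims
    follow from these facts.

    Circuits.  The relation [d_i * a_i = (f_i * d_0) * a_0] has coprime
    coefficients, so [x_i ^ d_i - x_0 ^ (f_i * d_0)] is a circuit
    ([circuit_two_variables]).  Modulo these circuits each monomial reduces to
    one whose exponent in [x_i] is below [d_i] for all [i != 0].  Reading the
    degree modulo [d_i] recovers the reduced exponent of [x_i]
    ([Adeg_exponent_mod]), and then the degree itself gives the exponent of
    [x_0].  Two monomials of equal degree thus have the same reduction, so their
    difference lies in the ideal of the circuits ([binomial_reduction]).

    Freeness.  Among the generators that follow [a_i] in the arrangement
    [a_1, ..., a_n, a_0] there is [a_0], and all of them are divisible by [d_i].
    Hence the least common multiple of [a_i] and their greatest common divisor
    is a multiple of [d_i * a_i], thus of [a_0], and lies in the span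
    ([dvdn_lcm_gcd_seq]). *)

Set Implicit Arguments.
Unset Strict Implicit.
Unset Printing Implicit Defensive.

Import GRing.Theory.

(** * Ideals presented by finite combinations of generators *)

Lemma ideal_gen_gen (R : comNzRingType) (G : R -> Prop) (g : R) :
  G g -> ideal_gen G g.
Proof.
move=> Gg; exists [:: (1, g)%R]; split; last by rewrite big_seq1 mul1r.
by move=> cg; rewrite inE => /eqP ->.
Qed.

Lemma ideal_gen0 (R : comNzRingType) (G : R -> Prop) : ideal_gen G 0%R.
Proof. by exists [::]; split=> //; rewrite big_nil. Qed.

Lemma ideal_genD (R : comNzRingType) (G : R -> Prop) (p q : R) :
  ideal_gen G p -> ideal_gen G q -> ideal_gen G (p + q)%R.
Proof.
move=> [s [Gs ->]] [t [Gt ->]]; exists (s ++ t); split; last by rewrite big_cat.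
by move=> cg; rewrite mem_cat => /orP[/Gs | /Gt].
Qed.

Lemma ideal_genMl (R : comNzRingType) (G : R -> Prop) (a p : R) :
  ideal_gen G p -> ideal_gen G (a * p)%R.
Proof.
move=> [s [Gs ->]]; exists [seq (a * cg.1, cg.2)%R | cg <- s]; split.
  by move=> _ /mapP[cg /Gs Gcg ->].
by rewrite big_map mulr_sumr; apply: eq_bigr => cg _; rewrite mulrA.
Qed.

Lemma ideal_genB (R : comNzRingType) (G : R -> Prop) (p q : R) :
  ideal_gen G p -> ideal_gen G q -> ideal_gen G (p - q)%R.
Proof.
by move=> Gp Gq; apply: ideal_genD => //; rewrite -mulN1r; apply: ideal_genMl.
Qed.

Lemma ideal_gen_min (R : comNzRingType) (G H : R -> Prop) (p : R) :
  (forall g, G g -> ideal_gen H g) -> ideal_gen G p -> ideal_gen H p.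
Proof.
move=> GH [s [Gs ->]]; rewrite big_seq.
apply: (big_ind (ideal_gen H)) => [| p1 p2 | cg /Gs /GH].
- exact: ideal_gen0.
- exact: ideal_genD.
- exact: ideal_genMl.
Qed.

(** Congruence modulo the ideal is expressed by membership of the difference;
    its compatibility with products, powers and iterated products is what allows
    a monomial to be reduced one variable at a time. *)
Lemma ideal_gen_congM (R : comNzRingType) (G : R -> Prop) (p p' q q' : R) :
  ideal_gen G (p - p')%R -> ideal_gen G (q - q')%R ->
  ideal_gen G (p * q - p' * q')%R.
Proof.
move=> Gp Gq.
have -> : (p * q - p' * q' = q * (p - p') + p' * (q - q'))%R.
  by rewrite !mulrBr addrA (mulrC q p) (mulrC q p') subrK.
by apply: ideal_genD; apply: ideal_genMl.
Qed.

Lemma ideal_gen_cong_refl (R : comNzRingType) (G : R -> Prop) (p : R) :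
  ideal_gen G (p - p)%R.
Proof. by rewrite subrr; apply: ideal_gen0. Qed.

Lemma ideal_gen_congX (R : comNzRingType) (G : R -> Prop) (p p' : R) (k : nat) :
  ideal_gen G (p - p')%R -> ideal_gen G (p ^+ k - p' ^+ k)%R.
Proof.
move=> Gp; elim: k => [|k IHk]; first by rewrite !expr0; apply: ideal_gen_cong_refl.
by rewrite !exprS; apply: ideal_gen_congM.
Qed.

Lemma ideal_gen_cong_prod (R : comNzRingType) (G : R -> Prop) (I : finType)
    (P : pred I) (F F' : I -> R) :
  (forall i, P i -> ideal_gen G (F i - F' i)%R) ->
  ideal_gen G (\prod_(i | P i) F i - \prod_(i | P i) F' i)%R.
Proof.
move=> GF; apply: (big_ind2 (fun p q => ideal_gen G (p - q)%R)) => //.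
- exact: ideal_gen_cong_refl.
- by move=> p p' q q'; apply: ideal_gen_congM.
Qed.

(** * Binomials of a toric ideal *)

(** The substitution sending the i-th variable to [t ^ a_i] kills the toric
    ideal, and it sends a monomial to [t] to the power of its degree; hence a
    binomial of the ideal cannot have terms of different degrees. *)
Lemma toric_ideal_mbinomial (K : fieldType) (n : nat) (A : n.-tuple nat)
    (u v : 'X_{1..n}) :
  toric_ideal A (mbinomial K u v) <-> Adeg A u = Adeg A v.
Proof.
split=> [|eq_uv]; last by apply: ideal_gen_gen; exists u, v.
pose phi : {mpoly K[n]} -> {poly K} :=
  mmap (@polyC K) (fun i => ('X^(tnth A i))%R).
have phiX w : phi 'X_[w]%R = 'X^(Adeg A w)%R.
  rewrite /phi mmapX /mmap1 /Adeg -prodrXr.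
  by apply: eq_bigr => i _; rewrite -exprM mulnC.
case=> s [Gs Ds].
have: phi (mbinomial K u v) = 0%R.
  rewrite Ds /phi rmorph_sum big_seq big1 //= => cg /Gs[u' [v' [eq_uv' ->]]].
  rewrite rmorphM rmorphB /= -!/(phi _) !phiX eq_uv' subrr mulr0 //.
rewrite /mbinomial /phi rmorphB /= -!/(phi _) !phiX => /eqP; rewrite subr_eq0.
by move=> /eqP /(congr1 (fun p : {poly K} => size p)); rewrite !size_polyXn => -[].
Qed.

(** The degree determines the exponent of any one variable from the others. *)
Lemma Adeg_inj_off (n : nat) (A : n.-tuple nat) (k : 'I_n) (u v : 'X_{1..n}) :
  0 < tnth A k -> Adeg A u = Adeg A v -> (forall j, j != k -> u j = v j) ->
  u = v.
Proof.
move=> Ak0 eqA eq_off; apply/mnmP=> j.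
have [->|/eq_off //] := eqVneq j k.
apply/eqP; rewrite -(eqn_pmul2r Ak0); apply/eqP.
move: eqA; rewrite /Adeg (bigD1 k) //= [RHS](bigD1 k) //=.
rewrite (eq_bigr (fun i => v i * tnth A i)); last by move=> i /eq_off ->.
by move/addIn.
Qed.

(** As the generators are positive, no nonzero binomial of the ideal involves a
    single variable, so a support of size two is automatically minimal. *)
Lemma circuit_two_variables (K : fieldType) (n : nat) (A : n.-tuple nat)
    (i j : 'I_n) (p q : nat) :
  i != j -> 0 < tnth A i -> 0 < tnth A j -> 0 < p -> 0 < q -> coprime p q ->
  p * tnth A i = q * tnth A j ->
  circuit A (mbinomial K (U_(i) *+ p)%MM (U_(j) *+ q)%MM).
Proof.
move=> ij Ai0 Aj0 p0 q0 cop_pq Dpq.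
have suppU (k : 'I_n) m : 0 < m -> supp (U_(k) *+ m)%MM = [set k].
  move=> m0; apply/setP=> l; rewrite !inE mulmnE mnm1E (eq_sym k l).
  by case: (l == k); rewrite ?mul1n ?mul0n -?lt0n.
have AdegU (k : 'I_n) m : Adeg A (U_(k) *+ m)%MM = m * tnth A k.
  rewrite /Adeg (bigD1 k) //= big1 => [|l /negPf neq_lk].
    by rewrite addn0 mulmnE mnm1E eqxx mul1n.
  by rewrite mulmnE mnm1E eq_sym neq_lk.
exists (U_(i) *+ p)%MM, (U_(j) *+ q)%MM; split=> //.
  split.
  - by apply/toric_ideal_mbinomial; rewrite !AdegU.
  - by rewrite !suppU //; apply/eqP; rewrite setI_eq0 disjoints1 inE.
  - apply/eqP; rewrite -dvdn1 -(eqP cop_pq) dvdn_gcd.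
    have ji : (j == i) = false by rewrite eq_sym (negPf ij).
    apply/andP; split.
      by apply: (@biggcdn_inf _ i);
        rewrite !mulmnE !mnm1E eqxx ji mul1n mul0n addn0 -?lt0n.
    by apply: (@biggcdn_inf _ j);
      rewrite !mulmnE !mnm1E eqxx (negPf ij) mul1n mul0n add0n -?lt0n.
move=> u v nz_uv /toric_ideal_mbinomial eq_uv; rewrite !suppU // => sub_uv.
have ne_uv : u <> v by move=> Duv; apply: nz_uv; rewrite Duv /mbinomial subrr.
(* If [k] were absent, [u] and [v] would agree off [l], hence be equal. *)
have in_supp (k l : 'I_n) :
    0 < tnth A l -> supp u :|: supp v \subset [set k; l] ->
    k \in supp u :|: supp v.
  move=> Al0 sub_kl; apply/negPn/negP => notk; apply: ne_uv.
  apply: (Adeg_inj_off Al0 eq_uv) => m ne_ml.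
  have : m \notin supp u :|: supp v.
    apply/negP => m_uv; have := subsetP sub_kl _ m_uv.
    by rewrite !inE (negPf ne_ml) orbF => /eqP Dm; rewrite -Dm m_uv in notk.
  by rewrite !inE negb_or !negbK => /andP[/eqP -> /eqP ->].
apply/eqP; rewrite eqEsubset sub_uv; apply/subsetP=> k.
rewrite !inE => /orP[] /eqP ->.
  by have := in_supp i j Aj0 sub_uv; rewrite !inE.
by have := in_supp j i Ai0; rewrite [[set j; i]]setUC !inE; apply.
Qed.

(** * Reduction to a normal form *)

(** Working modulo [d i] isolates the [i]-th exponent, all the other generators
    being divisible by [d i]. *)
Lemma Adeg_exponent_mod (n : nat) (A : n.-tuple nat) (d : nat) (i : 'I_n)
    (u v : 'X_{1..n}) :
  coprime d (tnth A i) -> (forall j, j != i -> d %| tnth A j) ->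
  Adeg A u = Adeg A v -> u i = v i %[mod d].
Proof.
move=> cop_di dvd_d eq_uv.
have AdegE w : Adeg A w = w i * tnth A i %[mod d].
  rewrite /Adeg (bigD1 i) //= -modnDmr.
  have /eqP -> : d %| \sum_(j < n | j != i) w j * tnth A j.
    by apply: dvdn_sum => j /dvd_d; apply: dvdn_mull.
  by rewrite addn0.
have eq_mod : u i * tnth A i = v i * tnth A i %[mod d].
  by rewrite -!AdegE eq_uv.
apply/eqP; move/eqP: eq_mod.
wlog le_vu : u v {eq_uv} / v i <= u i => [wlog_uv|].
  case/orP: (leq_total (v i) (u i)) => le; first exact: wlog_uv.
  by rewrite eq_sym (eq_sym (u i %% d)); apply: wlog_uv.
by rewrite !eqn_mod_dvd ?leq_mul2r ?le_vu ?orbT // -mulnBl Gauss_dvdl.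
Qed.

(** Trading [x_i ^ d_i] for [x_0 ^ e_i] brings every exponent of index [i != 0]
    below [d_i].  Degrees are preserved, so by [Adeg_exponent_mod] the reduced
    exponents depend on the degree only, and then so does the exponent of
    [x_0]: monomials of equal degree have the same reduction. *)
Lemma binomial_reduction (K : fieldType) (n : nat) (A : n.+1.-tuple nat)
    (d e : 'I_n.+1 -> nat) (G : {mpoly K[n.+1]} -> Prop) (u v : 'X_{1..n.+1}) :
  0 < tnth A ord0 ->
  (forall i, i != ord0 -> d i * tnth A i = e i * tnth A ord0) ->
  (forall i, i != ord0 -> coprime (d i) (tnth A i)) ->
  (forall i j, i != ord0 -> j != i -> d i %| tnth A j) ->
  (forall i, i != ord0 -> G ('X_i ^+ d i - 'X_ord0 ^+ e i)%R) ->
  Adeg A u = Adeg A v -> ideal_gen G (mbinomial K u v).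
Proof.
move=> A0 deA cop_dA dvd_dA Gde eq_uv.
(* The normal form of [w] is [x_0] to the power [ex0 w] times the product of
   the other variables with their exponents reduced modulo the [d i]. *)
pose ex0 (w : 'X_{1..n.+1}) :=
  w ord0 + \sum_(i < n.+1 | i != ord0) e i * (w i %/ d i).
pose nf (w : 'X_{1..n.+1}) : {mpoly K[n.+1]} :=
  ('X_ord0 ^+ ex0 w * \prod_(i < n.+1 | i != ord0) 'X_i ^+ (w i %% d i))%R.
have nfP w : ideal_gen G ('X_[w] - nf w)%R.
  rewrite /nf /ex0 mpolyXE_id (bigD1 ord0) //= exprD -mulrA.
  apply: ideal_gen_congM; first exact: ideal_gen_cong_refl.
  rewrite -prodrXr -big_split /=; apply: ideal_gen_cong_prod => i i0.
  rewrite {1}(divn_eq (w i) (d i)) exprD mulnC !exprM.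
  apply: ideal_gen_congM; last exact: ideal_gen_cong_refl.
  by apply: ideal_gen_congX; apply: ideal_gen_gen; apply: Gde.
have AdegE w : Adeg A w = ex0 w * tnth A ord0
    + \sum_(i < n.+1 | i != ord0) (w i %% d i) * tnth A i.
  rewrite /Adeg /ex0 (bigD1 ord0) //= mulnDl -addnA; congr (_ + _).
  rewrite big_distrl -big_split /=; apply: eq_bigr => i i0.
  by rewrite mulnAC -deA // {1}(divn_eq (w i) (d i)) mulnDl -mulnA mulnC.
have eq_mod i : i != ord0 -> u i %% d i = v i %% d i.
  by move=> i0; apply: Adeg_exponent_mod (cop_dA i i0) _ eq_uv => j; apply: dvd_dA.
have eq_ex0 : ex0 u = ex0 v.
  apply/eqP; rewrite -(eqn_pmul2r A0); apply/eqP.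
  move: eq_uv; rewrite !AdegE.
  under eq_bigr => i i0 do rewrite (eq_mod i i0).
  by move/addIn.
have eq_nf : nf u = nf v.
  rewrite /nf eq_ex0; congr (_ * _)%R.
  by apply: eq_bigr => i i0; rewrite (eq_mod i i0).
have -> : (mbinomial K u v = ('X_[u] - nf u) - ('X_[v] - nf v))%R.
  by rewrite /mbinomial eq_nf opprB addrA subrK.
exact: ideal_genB.
Qed.

(** * Spans of lists and their rearrangements *)

Lemma nat_span_cat (s t : seq nat) (x : nat) :
  nat_span (s ++ t) x <->
  exists y z, [/\ x = y + z, nat_span s y & nat_span t z].
Proof.
have split_sum (w : nat -> nat) :
    \sum_(i < size (s ++ t)) w i * nth 0 (s ++ t) i =
    \sum_(i < size s) w i * nth 0 s i
    + \sum_(i < size t) w (size s + i) * nth 0 t i.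
  rewrite size_cat big_split_ord /=; congr (_ + _); apply: eq_bigr => i _.
    by rewrite nth_cat ltn_ord.
  by rewrite nth_cat ltnNge leq_addr /= addKn.
split=> [[w ->] | [y [z [-> [a ->] [b ->]]]]].
  rewrite split_sum; do 2!eexists; split; first reflexivity.
    by exists w.
  by exists (fun i => w (size s + i)).
pose w i := if i < size s then a i else b (i - size s).
exists w; rewrite split_sum /w; congr (_ + _); apply: eq_bigr => i _.
  by rewrite ltn_ord.
by rewrite ltnNge leq_addr /= addKn.
Qed.

Lemma nat_span_catC (s t : seq nat) (x : nat) :
  nat_span (s ++ t) x -> nat_span (t ++ s) x.
Proof.
move=> /nat_span_cat[y [z [-> ys zt]]]; apply/nat_span_cat.
by exists z, y; split=> //; rewrite addnC.
Qed.

Lemma nat_span_rot (k : nat) (s : seq nat) (x : nat) :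
  nat_span (rot k s) x <-> nat_span s x.
Proof.
rewrite /rot -{3}(cat_take_drop k s).
by split; apply: nat_span_catC.
Qed.

Lemma nat_span_rcons_dvd (s : seq nat) (a x : nat) :
  a %| x -> nat_span (rcons s a) x.
Proof.
case/dvdnP=> k ->; rewrite -cats1; apply/nat_span_cat.
exists 0, (k * a); split=> //.
  by exists (fun=> 0); rewrite big1.
by exists (fun=> k); rewrite big_ord_recl big_ord0 addn0.
Qed.

Lemma minimal_generating_set_rot (S : nat -> Prop) (k : nat) (s : seq nat) :
  minimal_generating_set S s -> minimal_generating_set S (rot k s).
Proof.
case=> uniq_s pos_s gen_s min_s; split.
- by rewrite rot_uniq.
- by rewrite (eq_all_r (mem_rot k s)).
- by move=> x; rewrite gen_s; split=> /nat_span_rot.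
- move=> B subB nsubB; apply: min_s => [x /subB | sub_sB].
    by rewrite mem_rot.
  by apply: nsubB => x; rewrite mem_rot; apply: sub_sB.
Qed.

(** As [d] divides the greatest common divisor of [s], it divides the least
    common multiple; so does [a], and the two are coprime; hence
    so does [d * a]. *)
Lemma dvdn_lcm_gcd_seq (d a b : nat) (s : seq nat) :
  coprime d a -> {in s, forall c, d %| c} -> b %| d * a ->
  b %| lcmn a (\big[gcdn/0]_(c <- s) c).
Proof.
move=> cop_da dvd_s /dvdn_trans; apply.
rewrite Gauss_dvd // dvdn_lcml andbT; apply: dvdn_trans (dvdn_lcmr _ _).
rewrite big_seq; apply: (big_ind (fun g => d %| g)) => [|g h dg dh|c /dvd_s //].
  exact: dvdn0.
by rewrite dvdn_gcd dg.
Qed.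

(** * Generators that are products of pairwise coprime integers *)

Theorem proposition3p23 (K : fieldType) (n : nat) (S : nat -> Prop)
    (A : n.+1.-tuple nat) (d f : 'I_n.+1 -> nat)
    (hS : numerical_semigroup S)
    (hA : minimal_generating_set S A)
    (hd0 : forall j : 'I_n.+1, 0 < d j)
    (hf0 : forall j : 'I_n.+1, 0 < f j)
    (hd : forall i j : 'I_n.+1, i != j -> coprime (d i) (d j))
    (hf1 : f ord0 = 1)
    (hdf : forall j : 'I_n.+1, coprime (d j) (f j))
    (hAdf : forall j : 'I_n.+1,
        tnth A j = f j * \prod_(i < n.+1 | i != j) d i) :
  circuit_numerical_semigroup K S A /\ free_for_arrangement S (rot 1 A).
Proof.
have A_gt0 i : 0 < tnth A i by rewrite hAdf muln_gt0 hf0 prodn_gt0.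
have dA i : d i * tnth A i = f i * d ord0 * tnth A ord0.
  rewrite !hAdf hf1 mul1n mulnCA -mulnA; congr (_ * _).
  by transitivity (\prod_i d i); [rewrite [RHS](bigD1 i) | rewrite (bigD1 ord0)].
have cop_dA i : coprime (d i) (tnth A i).
  rewrite hAdf coprimeMr hdf /=.
  apply: (big_ind (fun m => coprime (d i) m)) => [|k l ck cl|j ji].
  - exact: coprimen1.
  - by rewrite coprimeMr ck.
  - by apply: hd; rewrite eq_sym.
have dvd_dA i j : j != i -> d i %| tnth A j.
  by move=> ji; rewrite hAdf (bigD1 i) 1?eq_sym //= mulnCA dvdn_mulr.
split.
  split=> // p; split; apply: ideal_gen_min => g; last first.
    by case=> u [v [-> [uv_toric _ _] _]].
  case=> u [v [eq_uv ->]].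
  apply: (binomial_reduction (e := fun i => f i * d ord0)) eq_uv => // [i j _|i i0].
    exact: dvd_dA.
  rewrite !mpolyXn; apply: circuit_two_variables => //.
    by rewrite muln_gt0 hf0 hd0.
  by rewrite coprimeMr hdf hd.
split=> //; first exact: minimal_generating_set_rot.
move=> i; rewrite size_rot size_tuple /= => lt_in.
have [s DA] : exists s, A = tnth A ord0 :: s :> seq nat.
  exists (behead A); rewrite (tnth_nth 0).
  by case: (tval A) (size_tuple A).
have sz_s : size s = n by have := size_tuple A; rewrite DA => -[].
have nth_s k (lt_kn : k < n) : nth 0 s k = tnth A (lift ord0 (Ordinal lt_kn)).
  by rewrite (tnth_nth 0) {1}DA.
rewrite DA rot1_cons nth_rcons sz_s lt_in nth_s drop_rcons ?sz_s //.
set i1 := lift ord0 (Ordinal lt_in).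
apply: nat_span_rcons_dvd.
(* [d i1 * a_i1] is a multiple of [a_0], the last entry of the list. *)
apply: (@dvdn_lcm_gcd_seq (d i1)) => //; last by rewrite dA dvdn_mull.
move=> c; rewrite mem_rcons inE => /orP[/eqP -> | ]; first exact: dvd_dA.
move=> /(nthP 0)[k]; rewrite size_drop sz_s ltn_subRL => lt_kn.
rewrite nth_drop (nth_s _ lt_kn) => <-; apply: dvd_dA.
by rewrite -val_eqE /= /bump /= !add1n eqSS gtn_eqF // leq_addr.
Qed.
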